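(* Superhighness does not imply BLR-hardness: there is a superhigh set $A\subseteq\mathbb{N}$ such that $\mathrm{BLR}(\emptyset')\not\subseteq\mathrm{BLR}(A)$.
   Context: A set $A$ is superhigh if $A'\ge_{tt}\emptyset''$, where $A'$ is the Turing jump of $A$ and $\le_{tt}$ is truth-table reducibility. For a set $A$, $\mathrm{BLR}(A)$ is the class of functions $f:\omega\to\omega$ that are boundedly limit computable by $A$, meaning that there are an $A$-computable function $\tilde f:\omega\times\omega\to\omega$ and a computable function $g:\omega\to\omega$ (computable without oracle) such that for all $n$, $f(n)=\lim_s\tilde f(n,s)$ and the set $\{s:\tilde f(n,s)\ne\tilde f(n,s+1)\}$ has cardinality less than $g(n)$. $A$ is BLR-hard if $\mathrm{BLR}(\emptyset')\subseteq\mathrm{BLR}(A)$. *)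

(* Defs.v *)
From Stdlib Require Cantor.
From mathcomp Require Import all_boot.
From mathcomp Require Import boolp classical_sets functions cardinality.

Set Implicit Arguments.
Unset Strict Implicit.
Unset Printing Implicit Defensive.

Local Open Scope classical_set_scope.
Local Open Scope card_scope.

(* Oracle computability is set up with Kleene's mu-recursive functions relative
   to an oracle, in unary form: several arguments are packed into one number
   with the Cantor pairing bijection. *)
Definition pr (x y : nat) : nat := Cantor.to_nat (x, y).

Inductive prog : Type :=
| Zero
| Succ
| Fst
| Snd
| Oracle
| Pair of prog & prog
| Comp of prog & prog
| Prec of prog & prog
| Mu of prog.

(* [eval A c x y]: the program c with oracle A, run on input x, halts with
   output y.
   - Oracle is the characteristic function of A;
   - Prec f g maps (a, 0) to f a, and (a, i.+1) to g (a, (i, r)), where r is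
     the value at (a, i); the function r below is the sequence of these values;
   - Mu f maps a to the least y such that f (a, y) = 0, and is defined only if
     f is defined at all (a, m) with m < y. *)
Fixpoint eval (A : set nat) (c : prog) (x y : nat) {struct c} : Prop :=
  match c with
  | Zero => y = 0
  | Succ => y = x.+1
  | Fst => y = (Cantor.of_nat x).1
  | Snd => y = (Cantor.of_nat x).2
  | Oracle => A x /\ y = 1 \/ ~ A x /\ y = 0
  | Pair f g => exists u v, [/\ eval A f x u, eval A g x v & y = pr u v]
  | Comp f g => exists2 u, eval A g x u & eval A f u y
  | Prec f g =>
      let: (a, n) := Cantor.of_nat x in
      exists r : nat -> nat,
        [/\ eval A f a (r 0),
            forall i, i < n -> eval A g (pr a (pr i (r i))) (r i.+1)
          & y = r n]
  | Mu f =>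
      eval A f (pr x y) 0 /\
      forall m, m < y -> exists v, eval A f (pr x m) v.+1
  end.

Definition computable_in (A : set nat) (f : nat -> nat) : Prop :=
  exists c, forall n, eval A c n (f n).

Definition computable_in2 (A : set nat) (f : nat -> nat -> nat) : Prop :=
  exists c, forall n s, eval A c (pr n s) (f n s).

Definition computable (f : nat -> nat) : Prop := computable_in set0 f.

(* Goedel numbering of programs. *)
Fixpoint encode (c : prog) : nat :=
  match c with
  | Zero => pr 0 0
  | Succ => pr 1 0
  | Fst => pr 2 0
  | Snd => pr 3 0
  | Oracle => pr 4 0
  | Pair f g => pr 5 (pr (encode f) (encode g))
  | Comp f g => pr 6 (pr (encode f) (encode g))
  | Prec f g => pr 7 (pr (encode f) (encode g))
  | Mu f => pr 8 (encode f)
  end.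

(* The e-th partial A-computable function is the one computed by the program
   with number e, and the empty function if e is not the number of a program. *)
Definition phi (A : set nat) (e x y : nat) : Prop :=
  exists2 c, encode c = e & eval A c x y.

Definition jump (A : set nat) : set nat := [set e | exists y, phi A e e y].

(* The number m = (q, t) codes the truth-table condition whose queries are the
   entries x_0, ..., x_(k-1) of the list coded by q, and whose table is t: with
   b_i the truth value of "x_i \in C", the answers of C select row
   sum_i b_i 2^i, and C satisfies the condition iff the binary digit of t in
   that position is 1. *)
Definition tt_row (C : set nat) (s : seq nat) : nat :=
  \sum_(i < size s) `[< C (nth 0 s i) >] * 2 ^ i.

Definition tt_sat (C : set nat) (m : nat) : Prop :=
  let: (q, t) := Cantor.of_nat m in
  odd (t %/ 2 ^ tt_row C (CodeSeq.decode q)).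

Definition tt_reducible (B C : set nat) : Prop :=
  exists2 h : nat -> nat, computable h & forall n, B n <-> tt_sat C (h n).

Definition superhigh (A : set nat) : Prop :=
  tt_reducible (jump (jump set0)) (jump A).

Definition limit_of (u : nat -> nat) (l : nat) : Prop :=
  exists s0, forall s, s0 <= s -> u s = l.

Definition BLR (A : set nat) : set (nat -> nat) :=
  [set f | exists (ft : nat -> nat -> nat) (g : nat -> nat),
    [/\ computable_in2 A ft,
        computable g
      & forall n, limit_of (ft n) (f n) /\
          exists2 k, k < g n & [set s | ft n s <> ft n s.+1] #= `I_k]].

Definition BLR_hard (A : set nat) : Prop := BLR (jump set0) `<=` BLR A.

(* Main.v *)
Require Import Defs.
From mathcomp Require Import all_boot.
From mathcomp Require Import boolp classical_sets functions cardinality.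
From mathcomp Require Import zify.
From Stdlib Require Cantor.

Set Implicit Arguments.
Unset Strict Implicit.
Unset Printing Implicit Defensive.

Local Open Scope classical_set_scope.
Local Open Scope card_scope.

(** [gen] is built in Friedberg's style as a union of finite strings. Even levels
    append one bit of the set [coded]; odd levels let one program move the
    current string to an extension, if it halts on that string. Once the
    outcomes of the levels are guessed, the string of a level is computed by a
    program whose code is obtained arithmetically from the codes of the
    programs that acted, so no universal program is needed. The outcomes are
    answers of the jump of [gen], and asking for them along a binary tree is a
    truth-table reduction: [gen] is superhigh.

    The value at [n] of a limit approximation computable in [gen] with [k]
    changes is decided by the string of one known level, so it is one of
    finitely many numbers computed by programs with computable codes. The
    halting problem can avoid them all, changing its mind at most once. *)

(** * Pairing, and determinism of evaluation *)

Arguments pr : simpl never.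

Definition pi1 (x : nat) : nat := (Cantor.of_nat x).1.
Definition pi2 (x : nat) : nat := (Cantor.of_nat x).2.

Lemma pr1K x y : pi1 (pr x y) = x.
Proof. by rewrite /pi1 /pr Cantor.cancel_of_to. Qed.

Lemma pr2K x y : pi2 (pr x y) = y.
Proof. by rewrite /pi2 /pr Cantor.cancel_of_to. Qed.

Definition prK := (pr1K, pr2K).

Lemma pr_eta x : pr (pi1 x) (pi2 x) = x.
Proof. by rewrite /pr /pi1 /pi2 -surjective_pairing Cantor.cancel_to_of. Qed.

Lemma pr_inj x y x' y' : pr x y = pr x' y' -> x = x' /\ y = y'.
Proof. by move=> /[dup] /(congr1 pi1) + /(congr1 pi2); rewrite !prK. Qed.

Lemma of_natE x : Cantor.of_nat x = (pi1 x, pi2 x).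
Proof. by rewrite /pi1 /pi2 -surjective_pairing. Qed.

Lemma leq_prr x y : y <= pr x y.
Proof.
have := Cantor.to_nat_non_decreasing x y; rewrite -/(pr x y) => /leP.
exact: leq_trans (leq_addr _ _).
Qed.

Lemma pr_lt_sqr x y B : x <= B -> y <= B -> pr x y < (2 * B + 2) ^ 2.
Proof. by have := Cantor.to_nat_spec x y; rewrite -/(pr x y) => E xB yB; nia. Qed.

Lemma eval_fun A c x y z : eval A c x y -> eval A c x z -> y = z.
Proof.
elim: c x y z => [||||||||] /=; try by move=> x y z -> ->.
- by move=> x y z [] [? ->] [] [? ->].
- move=> f IHf g IHg x y z [u [v [fu gv ->]]] [u' [v' [fu' gv' ->]]].
  by rewrite (IHf _ _ _ fu fu') (IHg _ _ _ gv gv').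
- move=> f IHf g IHg x y z [u gu fu] [v gv fv].
  by rewrite (IHg _ _ _ gu gv) in fu; exact: IHf fu fv.
- move=> f IHf g IHg x y z; rewrite of_natE.
  move=> [r [r0 rS ->]] [s [s0 sS ->]].
  have: pi2 x <= pi2 x by [].
  elim: {-2}(pi2 x) => [_|n IHn lt_n]; first exact: IHf r0 s0.
  by have := rS _ lt_n; rewrite IHn 1?ltnW // => /IHg; apply; exact: sS.
- move=> f IHf x y z [fy lty] [fz ltz].
  case: (ltngtP y z) => // [/ltz|/lty] [v fv].
    by have := IHf _ _ _ fv fy.
  by have := IHf _ _ _ fv fz.
Qed.

(* [D] is a class of oracles: [setT] for oracle-independent programs. *)
Definition computable_on (D : set (set nat)) (f : nat -> nat) : Prop :=
  exists c, forall X, D X -> forall n, eval X c n (f n).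

(** * Closure properties of functions computable uniformly over a class of oracles *)

Section Closure.
Variable D : set (set nat).
Implicit Types f g h n : nat -> nat.
Local Notation co := (computable_on D).

Lemma computable_on_ext f g : f =1 g -> co f -> co g.
Proof. by move=> /funext ->. Qed.

Lemma co_id : co (fun x => x).
Proof. by exists (Pair Fst Snd) => X _ x; exists (pi1 x), (pi2 x); rewrite pr_eta. Qed.

Lemma co_comp f g : co f -> co g -> co (fun x => f (g x)).
Proof.
by move=> [c cP] [d dP]; exists (Comp c d) => X DX x; exists (g x); auto.
Qed.

Lemma co_succ f : co f -> co (fun x => (f x).+1).
Proof. by apply: (co_comp (f := S)); exists Succ. Qed.

Lemma co_const k : co (fun=> k).
Proof. by elim: k => [|k]; [exists Zero | exact: co_succ]. Qed.

Lemma co_pr f g : co f -> co g -> co (fun x => pr (f x) (g x)).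
Proof.
by move=> [c cP] [d dP]; exists (Pair c d) => X DX x; exists (f x), (g x); split; auto.
Qed.

Lemma co_pi1 f : co f -> co (fun x => pi1 (f x)).
Proof. by apply: (co_comp (f := pi1)); exists Fst. Qed.

Lemma co_pi2 f : co f -> co (fun x => pi2 (f x)).
Proof. by apply: (co_comp (f := pi2)); exists Snd. Qed.

(** Most closure lemmas below reduce to this one. [Prec] carries one parameter through its loop;
    taking the whole input [x] as that parameter lets the base, the step and the number of steps all
    depend on [x]. *)
Lemma co_rec f n (G : nat -> nat -> nat -> nat) :
    co f -> co n -> co (fun z => G (pi1 z) (pi1 (pi2 z)) (pi2 (pi2 z))) ->
  co (fun x => nat_rect (fun=> nat) (f x) (G x) (n x)).
Proof.
move=> cf [d dP] [c cP].
pose h z := nat_rect (fun=> nat) (f (pi1 z)) (G (pi1 z)) (pi2 z).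
suff ch : co h.
  apply: (computable_on_ext (f := fun x => h (pr x (n x)))).
    by move=> x; rewrite /h !prK.
  by apply: co_comp => //; apply: co_pr; [exact: co_id | exists d].
case: cf => b bP; exists (Prec b c) => X DX z /=; rewrite of_natE.
exists (nat_rect (fun=> nat) (f (pi1 z)) (G (pi1 z))); split=> //= [|i _].
  exact: bP.
by have := cP X DX (pr (pi1 z) (pr i (nat_rect (fun=> nat) (f (pi1 z)) (G (pi1 z)) i)));
  rewrite !prK.
Qed.

Lemma co_if0 f g h : co f -> co g -> co h ->
  co (fun x => if f x == 0 then g x else h x).
Proof.
move=> cf cg ch.
apply: (computable_on_ext
  (f := fun x => nat_rect (fun=> nat) (g x) (fun _ _ => h x) (f x))).
  by move=> x; case: (f x).
by apply: co_rec => //; apply: co_comp => //; apply/co_pi1/co_id.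
Qed.

Lemma co_pred f : co f -> co (fun x => (f x).-1).
Proof.
apply: (co_comp (f := predn)).
apply: (computable_on_ext
  (f := fun x => nat_rect (fun=> nat) 0 (fun i _ => i) x)); first by case.
apply: co_rec; [exact: co_const | exact: co_id |].
by apply: co_pi1; apply: co_pi2; exact: co_id.
Qed.

Lemma co_add f g : co f -> co g -> co (fun x => f x + g x).
Proof.
move=> cf cg; apply: (computable_on_ext
  (f := fun x => nat_rect (fun=> nat) (f x) (fun _ r => r.+1) (g x))).
  by move=> x; elim: (g x) => [|n /= ->]; rewrite ?addn0 ?addnS.
by apply: co_rec => //; apply/co_succ/co_pi2/co_pi2/co_id.
Qed.

Lemma co_double f : co f -> co (fun x => (f x).*2).
Proof.
move=> cf; apply: (computable_on_ext (f := fun x => f x + f x)).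
  by move=> x; rewrite addnn.
exact: co_add.
Qed.

Lemma co_sub f g : co f -> co g -> co (fun x => f x - g x).
Proof.
move=> cf cg; apply: (computable_on_ext
  (f := fun x => nat_rect (fun=> nat) (f x) (fun _ r => r.-1) (g x))).
  by move=> x; elim: (g x) => [|n /= ->]; rewrite ?subn0 ?subnS.
by apply: co_rec => //; apply/co_pred/co_pi2/co_pi2/co_id.
Qed.

Lemma co_mul f g : co f -> co g -> co (fun x => f x * g x).
Proof.
move=> cf cg; apply: (computable_on_ext
  (f := fun x => nat_rect (fun=> nat) 0 (fun _ r => r + f x) (g x))).
  by move=> x; elim: (g x) => [|n /= ->]; rewrite ?muln0 // mulnS addnC.
apply: co_rec => //; first exact: co_const.
apply: co_add; first exact/co_pi2/co_pi2/co_id.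
by apply: co_comp => //; apply/co_pi1/co_id.
Qed.

Lemma co_exp2 f : co f -> co (fun x => 2 ^ f x).
Proof.
move=> cf; apply: (computable_on_ext
  (f := fun x => nat_rect (fun=> nat) 1 (fun _ r => r + r) (f x))).
  by move=> x; elim: (f x) => [|n /= ->] //; rewrite addnn expnS mul2n.
apply: co_rec => //; first exact: co_const.
by apply: co_add; exact/co_pi2/co_pi2/co_id.
Qed.

Lemma co_odd f : co f -> co (fun x => odd (f x)).
Proof.
move=> cf; apply: (computable_on_ext
  (f := fun x => nat_rect (fun=> nat) 0 (fun _ r => 1 - r) (f x))).
  by move=> x; elim: (f x) => [|n /= ->] //; case: (odd n).
apply: co_rec => //; first exact: co_const.
by apply: co_sub; [exact: co_const | exact/co_pi2/co_pi2/co_id].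
Qed.

Lemma co_half f : co f -> co (fun x => (f x)./2).
Proof.
move=> cf; apply: (computable_on_ext
  (f := fun x => nat_rect (fun=> nat) 0 (fun i r => r + odd i) (f x))).
  move=> x; elim: (f x) => [|n /= ->] //.
  by rewrite uphalf_half addnC.
apply: co_rec => //; first exact: co_const.
apply: co_add; first exact/co_pi2/co_pi2/co_id.
exact/co_odd/co_pi1/co_pi2/co_id.
Qed.

Lemma co_divexp2 f g : co f -> co g -> co (fun x => f x %/ 2 ^ g x).
Proof.
move=> cf cg; apply: (computable_on_ext
  (f := fun x => nat_rect (fun=> nat) (f x) (fun _ r => r./2) (g x))).
  move=> x; elim: (g x) => [|n /= ->]; first by rewrite divn1.
  by rewrite expnSr divnMA divn2.
by apply: co_rec => //; apply/co_half/co_pi2/co_pi2/co_id.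
Qed.

Lemma co_eq f g : co f -> co g -> co (fun x => f x == g x).
Proof.
move=> cf cg; apply: (computable_on_ext
  (f := fun x => 1 - ((f x - g x) + (g x - f x)))); first by move=> x; lia.
by do !(apply: co_sub || apply: co_add || apply: co_const || assumption).
Qed.

Lemma co_leq f g : co f -> co g -> co (fun x => f x <= g x).
Proof.
move=> cf cg; apply: (computable_on_ext
  (f := fun x => 1 - (f x - g x))); first by move=> x; lia.
by do !(apply: co_sub || apply: co_const || assumption).
Qed.

Lemma co_if (b : nat -> bool) g h : co b -> co g -> co h ->
  co (fun x => if b x then g x else h x).
Proof.
move=> cb cg ch; apply: (computable_on_ext
  (f := fun x => if b x == 0 :> nat then h x else g x)).
  by move=> x; case: (b x).
exact: co_if0.
Qed.

Lemma co_ifb (b c d : nat -> bool) : co b -> co c -> co d ->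
  co (fun x => if b x then c x else d x).
Proof.
move=> cb cc cd; apply: computable_on_ext (co_if cb cc cd) => x.
by case: (b x).
Qed.

Lemma co_neg (b : nat -> bool) : co b -> co (fun x => ~~ b x).
Proof. by move=> cb; apply: (co_ifb (c := xpred0) (d := xpredT)) => //; exact: co_const. Qed.

Lemma co_and (b c : nat -> bool) : co b -> co c -> co (fun x => b x && c x).
Proof. by move=> cb cc; apply: (co_ifb (d := xpred0)) => //; exact: co_const. Qed.

Lemma co_sum f (G : nat -> nat -> nat) :
  co f -> co (fun z => G (pi1 z) (pi2 z)) -> co (fun x => \sum_(i < f x) G x i).
Proof.
move=> cf cG; apply: (computable_on_ext
  (f := fun x => nat_rect (fun=> nat) 0 (fun i r => r + G x i) (f x))).
  by move=> x; elim: (f x) => [|n /= ->]; rewrite ?big_ord0 ?big_ord_recr.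
apply: co_rec => //; first exact: co_const.
apply: co_add; first exact/co_pi2/co_pi2/co_id.
apply: (computable_on_ext (f := fun z => (fun z => G (pi1 z) (pi2 z))
  (pr (pi1 z) (pi1 (pi2 z))))); first by move=> z; rewrite !prK.
apply: (co_comp cG); apply: co_pr; first exact/co_pi1/co_id.
exact/co_pi1/co_pi2/co_id.
Qed.

End Closure.

Definition all_below (n : nat) (b : pred nat) : bool := [forall i : 'I_n, b i].

Lemma all_belowP n (b : pred nat) :
  reflect (forall i, i < n -> b i) (all_below n b).
Proof.
apply: (iffP forallP) => [bP i lt_i|bP i]; first exact: bP (Ordinal lt_i).
exact: bP.
Qed.

Lemma co_all_below (D : set (set nat)) f (b : nat -> pred nat) :
    computable_on D f -> computable_on D (fun z => b (pi1 z) (pi2 z)) ->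
  computable_on D (fun x => all_below (f x) (b x)).
Proof.
move=> cf cb; apply: (computable_on_ext
  (f := fun x => \sum_(i < f x) (~~ b x i) == 0)).
  move=> x; congr (nat_of_bool _); apply/eqP/all_belowP => [/eqP|bP].
    rewrite sum_nat_eq0 => /forallP bP i lt_i.
    by have := bP (Ordinal lt_i); rewrite eqb0 negbK.
  by rewrite big1 // => i _; rewrite bP.
apply: (co_eq (g := fun=> 0)); last exact: co_const.
apply: (co_sum (G := fun x i => nat_of_bool (~~ b x i)) cf).
exact: (co_neg (b := fun z => b (pi1 z) (pi2 z)) cb).
Qed.

Create HintDb comput discriminated.
#[local] Hint Constants Opaque : comput.
#[local] Hint Resolve co_id co_const co_succ co_pred co_pr co_pi1 co_pi2 : comput.
#[local] Hint Resolve co_add co_sub co_mul co_double co_half co_exp2 co_odd : comput.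
#[local] Hint Resolve co_divexp2 co_eq co_leq co_neg co_and co_if co_ifb : comput.
#[local] Hint Resolve co_rec co_all_below : comput.
#[local] Hint Extern 1 (computable_on ?D (fun x => ?F (@?f x))) =>
  match goal with
  | H : computable_on D F |- _ => refine (@co_comp _ F f H _)
  end : comput.

(** Follows the syntax of an explicit expression. Constants are opaque in the hint database, so that
    unification does not unfold arithmetic. *)
Ltac comput := solve [auto 100 with comput nocore].

(** * Finite binary strings coded by numbers *)

Definition slen (t : nat) : nat := pi1 t.
(** Every number is a string: its entries form an iterated pair, and any positive entry counts as
    the bit 1. Distinct numbers may code the same string. *)
Definition sbit (t x : nat) : bool := 0 < pi1 (iter x pi2 (pi2 t)).

Lemma co_sbit D f g : computable_on D f -> computable_on D g ->
  computable_on D (fun x => sbit (f x) (g x)).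
Proof.
move=> cf cg; apply: (computable_on_ext (f := fun x =>
  0 < pi1 (nat_rect (fun=> nat) (pi2 (f x)) (fun _ r => pi2 r) (g x)))).
  move=> x; rewrite /sbit /=; set n := g x.
  suff -> : nat_rect (fun=> nat) (pi2 (f x)) (fun _ r => pi2 r) n =
    iter n pi2 (pi2 (f x)) by [].
  by elim: n => //= n ->.
by comput.
Qed.

#[local] Hint Resolve co_sbit : comput.

Lemma string_of (b : nat -> bool) l :
  exists t, slen t = l /\ forall x, x < l -> sbit t x = b x.
Proof.
suff [w wP]: exists w, forall x, x < l -> (0 < pi1 (iter x pi2 w)) = b x.
  by exists (pr l w); rewrite /slen /sbit !prK.
elim: l b => [|l IHl] b; first by exists 0.
have [w wP] := IHl (b \o succn).
exists (pr (b 0) w) => -[_|x lt_x]; first by rewrite /= prK; case: (b 0).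
by rewrite iterSr prK wP.
Qed.

Definition sext (s t : nat) : Prop :=
  slen s <= slen t /\ forall x, x < slen s -> sbit t x = sbit s x.

Definition sextb (s t : nat) : bool :=
  (slen s <= slen t) && all_below (slen s) (fun x => sbit t x == sbit s x).

Lemma sextP s t : reflect (sext s t) (sextb s t).
Proof.
apply: (iffP andP) => [] [le_st bP]; split=> //.
  by move=> x lt_x; move/all_belowP/(_ x lt_x): bP => /eqP.
by apply/all_belowP => x lt_x; rewrite bP.
Qed.

Lemma sext_refl s : sext s s. Proof. by []. Qed.

Lemma sext_trans s t u : sext s t -> sext t u -> sext s u.
Proof.
move=> [le_st bst] [le_tu btu]; split=> [|x lt_x]; first exact: leq_trans le_tu.
by rewrite btu ?bst //; exact: leq_trans le_st.
Qed.

Lemma eqb_natE (a b : bool) : (a == b) = (a == b :> nat).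
Proof. by case: a b => [] []. Qed.

Lemma co_sextb D f g : computable_on D f -> computable_on D g ->
  computable_on D (fun x => sextb (f x) (g x)).
Proof.
move=> cf cg; apply: (computable_on_ext (f := fun x =>
  (pi1 (f x) <= pi1 (g x)) &&
  all_below (pi1 (f x)) (fun i => sbit (g x) i == sbit (f x) i :> nat))).
  move=> x; rewrite /sextb /slen; congr (nat_of_bool (_ && _)).
  by congr all_below; apply/funext => i; rewrite eqb_natE.
by comput.
Qed.

#[local] Hint Resolve co_sextb : comput.

(** * Initial segments of an oracle, and simulation of programs on them *)

Definition agree (t : nat) (X : set nat) : Prop :=
  forall x, x < slen t -> sbit t x <-> X x.

Lemma agree_string (X : set nat) l : exists2 t, slen t = l & agree t X.
Proof.
have [t [tl tP]] := string_of (fun x => `[< X x >]) l.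
by exists t => // x; rewrite tl => lt_x; rewrite tP //; split=> /asboolP.
Qed.

Lemma agree_sext s t X : agree s X -> agree t X -> slen s <= slen t -> sext s t.
Proof.
move=> sX tX le_st; split=> // x lt_x; apply/idP/idP.
  by move/(tX _ (leq_trans lt_x le_st)) => /sX -> .
by move/sX => /(_ lt_x)/tX -> //; exact: leq_trans le_st.
Qed.

(* [F (pr t x)] runs [c] on [x] with oracle queries answered by the finite
   string [t] and all searches cut off at the length of [t]; it is [y.+1] if
   this yields the output [y], and [0] if it fails. *)
Definition simulates (F : nat -> nat) (c : prog) : Prop :=
  [/\ computable_on setT F,
      forall X t x y, agree t X -> F (pr t x) = y.+1 -> eval X c x y
    & forall X x y, eval X c x y -> exists l, forall t, agree t X ->
        l <= slen t -> F (pr t x) = y.+1].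

(** Provides one length that suffices for all subcomputations of a recursion or a search. *)
Lemma uniform_bound (P : nat -> nat -> Prop) n :
    (forall i, i < n -> exists l, forall l', l <= l' -> P i l') ->
  exists l, forall i, i < n -> forall l', l <= l' -> P i l'.
Proof.
elim: n => [|n IHn] Pn; first by exists 0.
have [|l lP] := IHn; first by move=> i lt_i; apply: Pn; exact: ltnW.
have [m mP] := Pn n (leqnn _).
exists (maxn l m) => i; rewrite ltnS leq_eqVlt => /predU1P[->|lt_i] l'.
  by rewrite geq_max => /andP[_]; exact: mP.
by rewrite geq_max => /andP[+ _]; exact: lP.
Qed.

(** By induction on [c]: a halting computation has finitely many subcomputations, so a long enough
    initial segment of the oracle settles it. *)
Lemma simulation c : exists F, simulates F c.
Proof.
elim: c => [|||||f [F [cF Fs Fc]] g [G [cG Gs Gc]]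
  |f [F [cF Fs Fc]] g [G [cG Gs Gc]]
  |f [F [cF Fs Fc]] g [G [cG Gs Gc]]|f [F [cF Fs Fc]]].
- exists (fun=> 1); split; first by comput.
    by move=> X t x y _ [<-].
  by move=> X x y ->; exists 0.
- exists (fun z => (pi2 z).+2); split; first by comput.
    by move=> X t x y _; rewrite prK => -[<-].
  by move=> X x y ->; exists 0 => t _ _; rewrite prK.
- exists (fun z => (pi1 (pi2 z)).+1); split; first by comput.
    by move=> X t x y _; rewrite prK => -[<-].
  by move=> X x y ->; exists 0 => t _ _; rewrite prK.
- exists (fun z => (pi2 (pi2 z)).+1); split; first by comput.
    by move=> X t x y _; rewrite prK => -[<-].
  by move=> X x y ->; exists 0 => t _ _; rewrite prK.
- exists (fun z => if (pi2 z).+1 <= pi1 (pi1 z) then (sbit (pi1 z) (pi2 z)).+1 else 0).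
  split; first by comput.
    move=> X t x y tX; rewrite !prK; case: leqP => // lt_x [<-] /=.
    have := tX _ lt_x; case: (sbit t x) => -[tx xt]; [left|right]; split=> //.
      exact: tx.
    by move/xt.
  move=> X x y /= Xxy; exists x.+1 => t tX lt_x; rewrite !prK lt_x.
  have := tX _ lt_x; case: (sbit t x) Xxy => -[] [Xx ->] // [xt tx].
    by case: Xx; apply: xt.
  by have := tx Xx.
- exists (fun z => if F z == 0 then 0 else if G z == 0 then 0 else
    (pr (F z).-1 (G z).-1).+1); split; first by comput.
    move=> X t x y tX; case E: (F _) => [//|u]; case E': (G _) => [//|v] [<-].
    by exists u, v; split; [exact: Fs E | exact: Gs E' |].
  move=> X x y [u [v [/Fc [l lP] /Gc [m mP] ->]]].
  exists (maxn l m) => t tX; rewrite geq_max => /andP[lt_l lt_m].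
  by rewrite lP // mP.
- exists (fun z => if G z == 0 then 0 else F (pr (pi1 z) (G z).-1)); split.
  + by comput.
  + move=> X t x y tX; rewrite !prK; case E: (G _) => [//|u] /= E'.
    by exists u; [exact: Gs E | exact: Fs E'].
  move=> X x y [u /Gc [l lP] /Fc [m mP]].
  exists (maxn l m) => t tX; rewrite geq_max => /andP[lt_l lt_m].
  by rewrite lP //= !prK mP.
(* A failed step keeps the value at 0, so a positive final value certifies all earlier ones. *)
- pose r t a := nat_rect (fun=> nat) (F (pr t a)) (fun i r =>
    if r == 0 then 0 else G (pr t (pr a (pr i r.-1)))).
  exists (fun z => r (pi1 z) (pi1 (pi2 z)) (pi2 (pi2 z))); split.
  + by rewrite /r; comput.
  + move=> X t x y tX; rewrite !prK => ry /=; rewrite of_natE.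
    exists (fun i => (r t (pi1 x) i).-1).
    have r_gt0 i : i <= pi2 x -> 0 < r t (pi1 x) i.
      move=> le_i; have : 0 < r t (pi1 x) (pi2 x) by rewrite ry.
      elim: (pi2 x) le_i => [|n IHn]; first by rewrite leqn0 => /eqP ->.
      rewrite leq_eqVlt => /predU1P[->//|]; rewrite ltnS => /IHn + rn.
      by apply; move: rn => /=; case: (r t _ n).
    split=> [|i lt_i|]; last by rewrite ry.
      by apply: (Fs _ t) => //; rewrite prednK //; exact: r_gt0.
    apply: (Gs _ t) => //; rewrite prednK; last exact: r_gt0.
    by have := r_gt0 i (ltnW lt_i); rewrite /=; case: (r t _ i).
  move=> X x y /=; rewrite of_natE => -[s [s0 sS ->]].
  have [l lP] := Fc _ _ _ s0.
  (* [uniform_bound] speaks of lengths, so the strings are quantified inside the property, with [l]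
     as their exact length. *)
  have [m mP] := @uniform_bound (fun i l => forall t, agree t X -> l = slen t ->
    G (pr t (pr (pi1 x) (pr i (s i)))) = (s i.+1).+1) (pi2 x)
    (fun i lt_i => let: ex_intro l lP := Gc _ _ _ (sS i lt_i) in
      ex_intro _ l (fun l' ll' t tX tl =>
        lP t tX (eq_ind _ (fun k => l <= k) ll' _ tl))).
  exists (maxn l m) => t tX; rewrite geq_max => /andP[lt_l lt_m]; rewrite !prK.
  have: pi2 x <= pi2 x by [].
  elim: {-2}(pi2 x) => [_|n IHn lt_n] /=; first by rewrite lP.
  by rewrite IHn 1?ltnW //= (mP _ lt_n _ lt_m).
(* Three states: 0 while the search goes on, 1 when a simulation has failed, [i.+2] when [i] is the
   least zero. The final predecessor turns the first two into failure and the last into the output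
   [i]. *)
- pose r t a := nat_rect (fun=> nat) 0 (fun i r =>
    if r == 0 then
      if F (pr t (pr a i)) == 0 then 1 else
      if F (pr t (pr a i)) == 1 then i.+2 else 0
    else r).
  have rS t a n : r t a n.+1 = if r t a n == 0 then
      if F (pr t (pr a n)) == 0 then 1 else
      if F (pr t (pr a n)) == 1 then n.+2 else 0
    else r t a n by [].
  have r0P t a n : r t a n = 0 -> forall m, m < n -> exists v, F (pr t (pr a m)) = v.+2.
    elim: n => [//|n IHn]; rewrite rS; case: (eqVneq (r t a n)) => [rn|/eqP //].
    case: eqP => // Fn0; case: eqP => // Fn1 _ m.
    rewrite ltnS leq_eqVlt => /predU1P[->|]; last exact: IHn.
    by case: (F _) Fn0 Fn1 => [|[|v]] // _ _; exists v.
  exists (fun z => (r (pi1 z) (pi2 z) (pi1 (pi1 z))).-1); split.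
  + by rewrite /r; comput.
  + move=> X t x y tX; rewrite !prK.
    elim: (pi1 t) => [//|n IHn]; rewrite rS; case: eqP => [rn|//].
    case: eqP => //= Fn0; case: eqP => //= Fn1 [<-]; split.
      exact: (Fs _ t).
    by move=> m lt_m; have [v vP] := r0P _ _ _ rn m lt_m; exists v; exact: (Fs _ t).
  move=> X x y /= [fy flt].
  have [l lP] := Fc _ _ _ fy.
  have [m mP] := @uniform_bound (fun i l => forall t, agree t X -> l = slen t ->
    exists v, F (pr t (pr x i)) = v.+2) y
    (fun i lt_i => let: ex_intro v fv := flt i lt_i in
      let: ex_intro l lP := Fc _ _ _ fv in
      ex_intro _ l (fun l' ll' t tX tl => ex_intro _ v
        (lP t tX (eq_ind _ (fun k => l <= k) ll' _ tl)))).
  (* The search tries only arguments below the length of the string, hence [y.+1]. *)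
  exists (maxn (maxn l m) y.+1) => t tX; rewrite !geq_max => /andP[/andP[lt_l lt_m] lt_y].
  rewrite !prK.
  have r0 : r t x y = 0.
    have: y <= y by [].
    elim: {-2}y => [//|n IHn lt_n]; rewrite rS IHn 1?ltnW //=.
    by have [v ->] := mP _ lt_n _ lt_m _ tX erefl.
  have: y.+1 <= pi1 t by exact: lt_y.
  elim: (pi1 t) => [//|n IHn]; rewrite ltnS leq_eqVlt => /predU1P[<-|].
    by rewrite rS r0 lP.
  by move=> /IHn; rewrite rS; case: (r t x n).
Qed.

(** * Searches that do not depend on the oracle *)

Lemma co_search (q : nat -> nat) : computable_on setT q ->
  exists c, forall X x y, eval X c x y <->
    q (pr x y) = 0 /\ forall m, m < y -> q (pr x m) <> 0.
Proof.
move=> [c cP]; exists (Mu c) => X x y /=.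
have cE z v : eval X c z v <-> v = q z.
  by split=> [cv|->]; [exact: eval_fun cv (cP X I z) | exact: cP].
rewrite cE; split=> -[qy qlt]; split=> // m /qlt; rewrite ?cE.
  by move=> [v /cE <-].
by case E: (q _) => [//|v] _; exists v; apply/cE.
Qed.

(** The condition sought is expressed as [q] being 0, which is why its uses negate a boolean. The
    same [q] serves all oracles, so the outputs do not depend on the oracle. *)
Lemma co_search_ex (q : nat -> nat) : computable_on setT q ->
  exists c, [/\ forall X Y x y, eval X c x y -> eval Y c x y,
    forall X x y, eval X c x y -> q (pr x y) = 0
    & forall X x, (exists y, q (pr x y) = 0) -> exists y, eval X c x y].
Proof.
move=> /co_search [c cP]; exists c; split.
- by move=> X Y x y /cP /cP.
- by move=> X x y /cP [].
move=> X x [y qy]; have ex : exists y, q (pr x y) == 0 by exists y; apply/eqP.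
case: (ex_minnP ex) => z /eqP qz zmin; exists z; apply/cP; split=> // m.
by apply: contraPnot => /eqP /zmin; rewrite leqNgt => /negP.
Qed.

(** * Binary digits, and arithmetic on codes of programs *)

Definition bit (r v : nat) : bool := odd (r %/ 2 ^ v).

Lemma co_bit D f g : computable_on D f -> computable_on D g ->
  computable_on D (fun x => bit (f x) (g x)).
Proof. by move=> cf cg; rewrite /bit; comput. Qed.

#[local] Hint Resolve co_bit : comput.

Definition num (b : nat -> bool) (n : nat) : nat := \sum_(i < n) b i * 2 ^ i.

Lemma num_lt b n : num b n < 2 ^ n.
Proof.
elim: n => [|n IHn]; rewrite /num ?big_ord0 // big_ord_recr /= -/(num b n) expnS.
by case: (b n); lia.
Qed.

Lemma bit_num b n k : k < n -> bit (num b n) k = b k.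
Proof.
elim: n => // n IHn; rewrite ltnS leq_eqVlt => lt_k.
rewrite /num big_ord_recr /= -/(num b n); case/predU1P: lt_k => [->|lt_k].
  rewrite /bit addnC divnMDl ?expn_gt0 // divn_small ?num_lt // addn0.
  by case: (b n).
rewrite -IHn // /bit addnC -{2}(subnK (ltnW lt_k)) expnD mulnA.
by rewrite divnMDl ?expn_gt0 // oddD oddM oddX subn_eq0 leqNgt lt_k /= andbF.
Qed.

Fixpoint const_prog (n : nat) : prog :=
  if n is k.+1 then Comp Succ (const_prog k) else Zero.

Lemma eval_const X n x y : eval X (const_prog n) x y <-> y = n.
Proof.
elim: n y => //= n IHn y; split=> [[u /IHn -> ->] //|->].
by exists n => //; apply/IHn.
Qed.

(** Hard-wiring a number into a program is computable on codes; this takes the place of the s-m-n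
    theorem. *)
Lemma co_const_code D f : computable_on D f ->
  computable_on D (fun x => encode (const_prog (f x))).
Proof.
move=> cf; apply: (computable_on_ext (f := fun x => nat_rect (fun=> nat)
  (encode Zero) (fun _ r => pr 6 (pr (encode Succ) r)) (f x))).
  by move=> x; elim: (f x) => //= n ->.
by comput.
Qed.

#[local] Hint Resolve co_const_code : comput.

Lemma encode_inj c d : encode c = encode d -> c = d.
Proof.
elim: c d => [||||| f IHf g IHg | f IHf g IHg | f IHf g IHg | f IHf]
  [||||| f' g' | f' g' | f' g' | f'] //= /pr_inj [] // _;
  by [move/pr_inj => [/IHf -> /IHg ->] | move/IHf => ->].
Qed.

(** Only codes of programs belong to a jump. This recovers the component programs from a number
    assembled arithmetically. *)
Lemma encode_Comp Q i p : encode Q = pr 6 (pr i p) ->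
  exists c P, [/\ Q = Comp c P, encode c = i & encode P = p].
Proof.
case: Q => [||||| f g | f g | f g | f] /= /pr_inj [] // _ /pr_inj [<- <-].
by exists f, g.
Qed.

Lemma encode_neq9 Q n : encode Q <> pr 9 n.
Proof. by case: Q => [||||| f g | f g | f g | f] /= /pr_inj []. Qed.

Lemma jumpE X c : jump X (encode c) <-> exists y, eval X c (encode c) y.
Proof.
split=> [[y [d /encode_inj -> cy]]|[y cy]]; first by exists y.
by exists y, c.
Qed.

(** * The construction of [gen] *)

(** The program searches for an extension with bit [b] right after [s]. It may add further bits;
    only the bit at position [slen s] is read later. *)
Lemma app_prog_ex (b : bool) : exists c,
  [/\ forall X Y x y, eval X c x y -> eval Y c x y,
      forall X s t, eval X c s t ->
        [/\ sext s t, slen s < slen t & sbit t (slen s) = b]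
    & forall X s, exists t, eval X c s t].
Proof.
have [|c [cXY cP cT]] := @co_search_ex (fun z => ~~ (sextb (pi1 z) (pi2 z) &&
  ((pi1 (pi1 z) < pi1 (pi2 z)) && (sbit (pi2 z) (pi1 (pi1 z)) == b :> nat)))).
  by comput.
exists c; split=> //.
  move=> X s t /cP; rewrite !prK => /eqP; rewrite eqb0 negbK -eqb_natE.
  by case/and3P => /sextP st lt /eqP.
move=> X s; apply: cT.
have [t [tl tP]] := string_of
  (fun x => if x < slen s then sbit s x else b) (slen s).+1.
have st : sext s t.
  by split=> [|x lt_x]; rewrite ?tl // tP ?lt_x //; exact: ltnW.
exists t; rewrite !prK -eqb_natE (introT (sextP _ _) st) -/(slen s) -/(slen t).
by rewrite tl tP ?ltnn // ltnSn eqxx.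
Qed.

Definition app_prog (b : bool) : prog := projT1 (cid (app_prog_ex b)).

Lemma app_progP b :
  [/\ forall X Y x y, eval X (app_prog b) x y -> eval Y (app_prog b) x y,
      forall X s t, eval X (app_prog b) s t ->
        [/\ sext s t, slen s < slen t & sbit t (slen s) = b]
    & forall X s, exists t, eval X (app_prog b) s t].
Proof. by rewrite /app_prog; case: (cid _). Qed.

(** Turns an oracle bit into a halting question, which a jump can answer. The tested function
    ignores the search variable, so the search succeeds at once or never. *)
Lemma read_prog_ex : exists c, forall X s,
  (exists y, eval X c s y) <-> X (slen s).
Proof.
have [c cP] : computable_on setT (fun x => 1 - x) by comput.
exists (Mu (Comp c (Comp Oracle (Comp Fst Fst)))) => X s; split.
  move=> [y /= [[u [v [w -> ->] Xv] cu] _]].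
  rewrite -/(pi1 _) -/(pi1 _) prK in Xv; case: Xv => -[] // nXs u0.
  by have := eval_fun cu (cP X I u); rewrite u0.
move=> Xs; exists 0; split=> //; exists 1; last exact: (cP X I 1).
exists (slen s); last by left.
by exists s => //; rewrite /= -/(pi1 _) prK.
Qed.

Definition read_prog : prog := projT1 (cid read_prog_ex).

Lemma read_progP X s : (exists y, eval X read_prog s y) <-> X (slen s).
Proof. by rewrite /read_prog; case: (cid _) => c /=; apply. Qed.

(* Queries to the jump of [gen] run programs with oracle [gen], which depends on
   their outcome: hence the first requirement. *)
Definition good (c : prog) : Prop :=
  (forall X Y x y, eval X c x y -> eval Y c x y) /\
  (forall X s t, eval X c s t -> sext s t).

(* Codes of programs begin with a tag at most 8, so the numbers [pr 9 n] are
   free to carry the double jump. *)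
Definition coded : set nat :=
  [set i | (exists2 n, i = pr 9 n & jump (jump set0) n) \/
           (exists2 c, encode c = i & good c)].

Lemma coded_pr9 n : coded (pr 9 n) <-> jump (jump set0) n.
Proof.
split=> [[[m /pr_inj [_ ->]] //|[c /encode_neq9]] //|jn].
by left; exists n.
Qed.

Lemma coded_encode c : coded (encode c) <-> good c.
Proof.
split=> [[[m /encode_neq9]|[d /encode_inj ->]] //|gc].
by right; exists c.
Qed.

(** The choice of the oracle [set0] is immaterial, since [c] is good. *)
Definition forced (i s t : nat) : Prop :=
  exists c, [/\ encode c = i, good c & eval set0 c s t].

(** Level [k] leads from [stage k] to [stage k.+1]. Level [2i] records membership of [i] in [coded],
    so goodness of the program with number [i] is known before it may act at level [2i+1]. The
    default of the odd case leaves the string unchanged. *)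
Fixpoint stage (j : nat) : nat :=
  if j is k.+1 then
    if odd k then xget (stage k) (forced k./2 (stage k))
    else xget 0 (eval set0 (app_prog `[< coded k./2 >]) (stage k))
  else 0.

(** The one bit per level that suffices to compute the next string from the current one without an
    oracle. *)
Definition outcome (j : nat) : bool :=
  if odd j then `[< exists t, forced j./2 (stage j) t >] else `[< coded j./2 >].

Lemma stage_even j : ~~ odd j ->
  eval set0 (app_prog (outcome j)) (stage j) (stage j.+1).
Proof.
move=> nj; rewrite /outcome (negbTE nj) /= (negbTE nj).
by have [_ _ /(_ set0 (stage j))/(xgetPex 0)] := app_progP `[< coded j./2 >].
Qed.

Lemma stage_odd j : odd j -> outcome j ->
  forced j./2 (stage j) (stage j.+1).
Proof. by rewrite /outcome /= => -> /asboolP /xgetPex. Qed.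

Lemma stage_skip j : odd j -> ~~ outcome j -> stage j.+1 = stage j.
Proof.
rewrite /outcome /= => -> /asboolPn nf; apply: xgetPN => t ft.
by apply: nf; exists t.
Qed.

Lemma stage_sext_succ j : sext (stage j) (stage j.+1).
Proof.
case: (boolP (odd j)) => [oj|/stage_even]; last first.
  by have [_ eP _] := app_progP (outcome j) => /eP [].
case: (boolP (outcome j)) => [/(stage_odd oj) [c [_ [_ gc] /gc]] //|nj].
by rewrite stage_skip //; exact: sext_refl.
Qed.

Lemma stage_sext j k : j <= k -> sext (stage j) (stage k).
Proof.
move=> /subnKC <-; elim: (k - j) => [|n IHn]; first by rewrite addn0; exact: sext_refl.
by rewrite addnS; exact: sext_trans IHn (stage_sext_succ _).
Qed.

Definition gen : set nat :=
  [set x | exists2 j, x < slen (stage j) & sbit (stage j) x].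

Lemma agree_stage j : agree (stage j) gen.
Proof.
move=> x lt_x; split=> [sx|[k lt_k]]; first by exists j.
by case: (leqP j k) => [/stage_sext [_ ->]|/ltnW /stage_sext [_ ->]].
Qed.

Lemma gen_coded j : ~~ odd j -> gen (slen (stage j)) <-> coded j./2.
Proof.
move=> nj; have [_ eP _] := app_progP (outcome j).
have [_ lt sb] := eP _ _ _ (stage_even nj).
rewrite -(agree_stage lt) sb /outcome (negbTE nj).
by split=> /asboolP.
Qed.

(** * The truth-table reduction of the double jump to the jump of [gen] *)

(* The bits of [g] are guesses for the values of [outcome]. *)
Definition path_code (g j : nat) : nat :=
  nat_rect (fun=> nat) (encode Zero) (fun i p =>
    if odd i then (if bit g i then pr 6 (pr i./2 p) else p)
    else pr 6 (pr (if bit g i then encode (app_prog true)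
                   else encode (app_prog false)) p)) j.

(** At an odd level the guess at [j.-1] tells whether [j./2] is in [coded]. If not, the query is
    [pr 9 0], which codes no program and so lies in no jump. *)
Definition query (g j : nat) : nat :=
  if odd j then
    if bit g j.-1 then pr 6 (pr j./2 (path_code g j)) else pr 9 0
  else pr 6 (pr (encode read_prog) (path_code g j)).

Lemma co_path_code D f g : computable_on D f -> computable_on D g ->
  computable_on D (fun x => path_code (f x) (g x)).
Proof. by move=> cf cg; rewrite /path_code; comput. Qed.

#[local] Hint Resolve co_path_code : comput.

Lemma co_query D f g : computable_on D f -> computable_on D g ->
  computable_on D (fun x => query (f x) (g x)).
Proof. by move=> cf cg; rewrite /query; comput. Qed.

#[local] Hint Resolve co_query : comput.

Definition on_path (g j : nat) : Prop := forall i, i < j -> bit g i = outcome i.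

(** Each level composes one more program whose result is the same for all oracles, so the composite
    outputs [stage j] whatever its oracle and input. *)
Lemma path_codeP g j : on_path g j ->
  exists2 P, encode P = path_code g j &
    forall X x y, eval X P x y <-> y = stage j.
Proof.
elim: j => [_|j IHj gP]; first by exists Zero.
have [|P eP PP] := IHj; first by move=> i lt_i; apply: gP; exact: ltnW.
rewrite [path_code g j.+1]/= -/(path_code g j) -eP gP //.
have CompP c s t : (forall X Y x y, eval X c x y -> eval Y c x y) ->
    s = stage j -> eval set0 c s t ->
    forall X x y, eval X (Comp c P) x y <-> y = t.
  move=> cXY -> ct X x y; split=> [[u /PP ->] cy|->]; last first.
    by exists (stage j); [exact/PP | exact: cXY ct].
  by apply: eval_fun cy _; exact: cXY ct.
case: ifP => [oj|/negbT nj].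
  case: ifP => [/(stage_odd oj) [c [ec [cXY _] cs]]|/negbT np].
    by exists (Comp c P); [rewrite /= ec | exact: CompP cXY erefl cs].
  by exists P => //; rewrite stage_skip.
have [aXY _ _] := app_progP (outcome j).
exists (Comp (app_prog (outcome j)) P); first by case: (outcome j).
exact: CompP aXY erefl (stage_even nj).
Qed.

(** At an even level the query reads the bit of [gen] just after [stage j]. At an odd level it runs
    a good program, which halts with oracle [gen] exactly when it does with [set0]. *)
Lemma jump_query g j : on_path g j -> jump gen (query g j) <-> outcome j.
Proof.
move=> gP; have [P eP PP] := path_codeP gP; rewrite /query.
have jumpP c i : encode c = i ->
    jump gen (pr 6 (pr i (path_code g j))) <-> exists y, eval gen c (stage j) y.
  move=> <-; rewrite -eP -[pr 6 _]/(encode (Comp c P)) jumpE; split=> -[y].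
    by move=> [u /PP ->]; exists y.
  by move=> cy; exists y, (stage j) => //; exact/PP.
case: ifP => [oj|/negbT nj]; last first.
  rewrite (jumpP read_prog) // read_progP gen_coded // /outcome (negbTE nj).
  by split=> /asboolP.
have j0 : j = j.-1.+1 by case: (j) oj.
have oj1 : ~~ odd j.-1 by move: oj; rewrite {1}j0.
have hj1 : j.-1./2 = j./2 by rewrite {2}j0 /= uphalf_half (negbTE oj1).
rewrite gP; last by rewrite {2}j0.
rewrite {1}/outcome (negbTE oj1) hj1 /outcome oj.
case: asboolP => [ci|nci]; last first.
  split=> [[y [c /encode_neq9]] //|/asboolP [t [c [ec gc _]]]].
  by case: nci; rewrite -ec; exact/coded_encode.
split=> [jq|/asboolP [t [c [ec [cXY _] cs]]]]; last first.
  by rewrite (jumpP c) //; exists t; exact: cXY cs.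
(* [j./2] might be in [coded] as some [pr 9 n]. But the query is in a jump, hence codes a program,
   and so [j./2] codes one too. *)
apply/asboolP; have [_ [Q /encode_Comp [c [P' [_ ec _]] _]]] := jq.
move: jq; rewrite (jumpP c) // => -[y cy].
move: ci; rewrite -ec => /coded_encode gc.
by exists y, c; split=> //; case: gc => cXY _; exact: cXY cy.
Qed.

(* Positions in the list of queries are pairs of a level [j] and a node [g] of
   that level; [walk a j] is the node reached when [a] answers the queries. *)
Definition walk (a : nat -> bool) (j : nat) : nat :=
  nat_rect (fun=> nat) 0 (fun i g => g + a (pr i g) * 2 ^ i) j.

Lemma on_path_num j : on_path (num outcome j) j.
Proof. by move=> i lt_i; rewrite bit_num. Qed.

Lemma walk_path (a : nat -> bool) j :
    (forall i, i < j -> a (pr i (num outcome i)) = outcome i) ->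
  walk a j = num outcome j.
Proof.
elim: j => [_|j IHj aP]; first by rewrite /num big_ord0.
rewrite /= -/(walk a j) IHj => [|i lt_i]; last by apply: aP; exact: ltnW.
by rewrite aP // /num big_ord_recr.
Qed.

Definition queries (K : nat) : seq nat := mkseq (fun i => query (pi2 i) (pi1 i)) K.

(** The even level whose outcome is membership of [n] in the double jump. *)
Definition level (n : nat) : nat := pr 9 n + pr 9 n.
(** By [pr_lt_sqr], exceeds every position [pr j g] with [j] at most [level n] and [g] below
    [2 ^ level n]. *)
Definition nqueries (n : nat) : nat :=
  (2 * (level n + 2 ^ level n) + 2) * (2 * (level n + 2 ^ level n) + 2).
Definition verdict (n r : nat) : bool :=
  bit r (pr (level n) (walk (bit r) (level n))).
Definition condition (n : nat) : nat :=
  pr (CodeSeq.code (queries (nqueries n))) (num (verdict n) (2 ^ nqueries n)).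

(** Building the list from its last entry makes its code a primitive recursion. *)
Lemma code_map_iota (q : nat -> nat) K n : n <= K ->
  CodeSeq.code (map q (iota (K - n) n)) =
  nat_rect (fun=> nat) 0 (fun i r => 2 ^ q (K - i.+1) * (r + r).+1) n.
Proof.
elim: n => [//|n IHn] lt_n; rewrite /= addnn -IHn 1?ltnW //=.
by congr (_ * (CodeSeq.code (map q (iota _ _))).*2.+1); lia.
Qed.

Lemma co_condition : computable_on setT condition.
Proof.
apply: (computable_on_ext (f := fun n =>
  pr (nat_rect (fun=> nat) 0 (fun i r =>
       2 ^ query (pi2 (nqueries n - i.+1)) (pi1 (nqueries n - i.+1))
       * (r + r).+1) (nqueries n))
     (num (verdict n) (2 ^ nqueries n)))).
  move=> n; rewrite /condition /queries /mkseq; congr (pr _ _).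
  by rewrite -(code_map_iota (fun i => query (pi2 i) (pi1 i)) (leqnn _)) subnn.
have clevel : computable_on setT level by rewrite /level; comput.
have cK : computable_on setT nqueries by rewrite /nqueries; comput.
have ctable : computable_on setT (fun n => num (verdict n) (2 ^ nqueries n)).
  apply: (co_sum (G := fun n r => verdict n r * 2 ^ r)); first by comput.
  by rewrite /verdict /walk; comput.
by comput.
Qed.

Lemma tt_rowE C s : tt_row C s = num (fun i => `[< C (nth 0 s i) >]) (size s).
Proof. by []. Qed.

Lemma superhigh_gen : superhigh gen.
Proof.
exists condition => [|n].
  by have [c cP] := co_condition; exists c => n; exact: cP.
rewrite /tt_sat /condition of_natE !prK CodeSeq.codeK.
set K := nqueries n; set R := tt_row _ _.
have RE : R = num (fun i => `[< jump gen (nth 0 (queries K) i) >]) K.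
  by rewrite /R tt_rowE size_mkseq.
have R_lt : R < 2 ^ K by rewrite RE num_lt.
rewrite -/(bit _ R) bit_num // /verdict.
(* The true path is all that matters: queries at other nodes may get any answer, and the walk never
   looks at them. *)
have ans j : j <= level n -> bit R (pr j (num outcome j)) = outcome j.
  move=> le_j; have lt_K : pr j (num outcome j) < K.
    apply: leq_trans (pr_lt_sqr (B := level n + 2 ^ level n) _ _) _.
    - exact: leq_trans le_j (leq_addr _ _).
    - apply: leq_trans (ltnW (num_lt _ _)) (leq_trans _ (leq_addl _ _)).
      by rewrite leq_pexp2l.
    by rewrite expnS expn1.
  rewrite RE bit_num // nth_mkseq // !prK.
  have jq := jump_query (@on_path_num j).
  by apply/asboolP/idP => /jq.
rewrite walk_path => [|i lt_i]; last by apply: ans; exact: ltnW.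
rewrite ans // /outcome /level addnn odd_double doubleK.
by rewrite -coded_pr9; split=> /asboolP.
Qed.

(** * Tracing computations from [gen] by the string of one level *)

Definition id_prog : prog := Pair Fst Snd.

Lemma eval_id X x y : eval X id_prog x y <-> y = x.
Proof.
split=> [[u [v [-> -> ->]]]|->]; first exact: pr_eta.
by exists (pi1 x), (pi2 x); rewrite pr_eta.
Qed.

(** With [n] hard-wired, each argument has its own program number, and hence its own level at which
    to act. *)
Definition request (c : prog) (n : nat) : prog :=
  Comp c (Pair id_prog (const_prog n)).

Lemma eval_request X c n s t :
  eval X (request c n) s t <-> eval X c (pr s n) t.
Proof.
split=> [[z [u [v [su nv ->]]]]|ct].
  by move: su nv => /(eval_id X s u).1 -> /(eval_const X n s v).1 ->.
by exists (pr s n) => //; exists s, n; split=> //; [exact/eval_id | exact/eval_const].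
Qed.

(** The stage just after level [2i+1], where the program with number [i] acts. *)
Definition request_stage (i : nat) : nat := i.*2.+2.

(* Either some extension of the current stage makes [d] halt on [n], and the
   least one is taken, or [d] diverges on [n] for [gen]. *)
Lemma trace_program d F : simulates F d -> exists c, forall n y,
  eval gen d n y ->
  F (pr (stage (request_stage (encode (request c n)))) n) = y.+1.
Proof.
case=> cF Fs Fc.
have [|c [cXY cP cT]] := @co_search_ex (fun z =>
  ~~ (sextb (pi1 (pi1 z)) (pi2 z) && (0 < F (pr (pi2 z) (pi2 (pi1 z)))))).
  by comput.
exists c => n y dy; set i := encode _; set s := stage i.*2.+1.
have{}cP X t t' : eval X (request c n) t t' -> sext t t' /\ 0 < F (pr t' n).
  by move=> /eval_request /cP; rewrite !prK => /eqP; rewrite eqb0 negbK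
    => /andP[/sextP].
have gc : good (request c n).
  split=> [X Y x z /eval_request cx|X t t' /cP [] //].
  by apply/eval_request; exact: cXY cx.
(* A long initial segment of [gen] extends [s] and makes the simulation succeed, so the search halts
   and the request is met. *)
have [l lP] := Fc _ _ _ dy.
have [t tl tg] := agree_string gen (maxn l (slen s)).
have fs : exists t, forced i s t.
  have [|t' ct'] := cT set0 (pr s n).
    exists t; rewrite !prK lP ?tl ?leq_maxl //.
    suff /sextP -> : sext s t by [].
    by apply: (agree_sext (@agree_stage _) tg); rewrite tl leq_maxr.
  by exists t', (request c n); split=> //; exact/eval_request.
have oi : odd i.*2.+1 by rewrite /= odd_double.
have hi : i.*2.+1./2 = i by rewrite /= uphalf_double.
have [|c' [ec' _ cs]] := stage_odd oi; first by rewrite /outcome oi hi; exact/asboolP.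
rewrite hi in ec'; rewrite (encode_inj ec') in cs; rewrite -/(stage _.+1).
have [_] := cP _ _ _ cs; rewrite /request_stage.
case E: (F _) => [//|y'] _; congr _.+1.
exact: eval_fun (Fs _ _ _ _ (@agree_stage _) E) dy.
Qed.

(** * A diagonal function that the halting problem approximates with at most one change *)

Lemma co_oracle (O : set nat) f : computable_on [set O] f ->
  computable_on [set O] (fun x => `[< O (f x) >]).
Proof.
apply: (co_comp (f := fun x => nat_of_bool `[< O x >])).
by exists Oracle => X -> x /=; case: asboolP; [left | right].
Qed.

#[local] Hint Resolve co_oracle : comput.

Section FirstHit.
Variable P : nat -> bool.

(** The value is 0 until the least witness [i] is seen, then [i.+1] forever; the shift separates the
    witness 0 from no witness. *)
Definition first_hit (s : nat) : nat :=
  nat_rect (fun=> nat) 0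
    (fun i r => if r == 0 then if P i then i.+1 else 0 else r) s.

Lemma first_hitS s : first_hit s.+1 =
  if first_hit s == 0 then if P s then s.+1 else 0 else first_hit s.
Proof. by []. Qed.

Lemma first_hitP s z : first_hit s = z.+1 -> P z.
Proof.
elim: s => [//|s IHs]; rewrite first_hitS; case: eqP => // _.
by case: ifP => // Ps [<-].
Qed.

Lemma first_hit_stable s t : first_hit s <> 0 -> s <= t ->
  first_hit t = first_hit s.
Proof.
move=> s0 /subnKC <-; elim: (t - s) => [|n IHn]; first by rewrite addn0.
by rewrite addnS first_hitS IHn; case: eqP.
Qed.

Lemma first_hit_found z : P z -> first_hit z.+1 <> 0.
Proof. by rewrite first_hitS => ->; case: eqP. Qed.

Definition hit : nat := xget 0 [set y | limit_of first_hit y].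

Lemma hitP : limit_of first_hit hit.
Proof.
apply: xgetPex; case: (pselect (exists s, first_hit s <> 0)) => [[s s0]|ns].
  by exists (first_hit s), s => t /first_hit_stable ->.
by exists 0, 0 => s _; apply: contrapT => s0; apply: ns; exists s.
Qed.

Lemma hit_found : (exists z, P z) -> exists2 z, P z & hit = z.+1.
Proof.
case=> z /first_hit_found z0; have [s sP] := hitP.
have := sP _ (leq_maxl s z.+1).
rewrite (first_hit_stable z0) ?leq_maxr // => E.
case Ez: (first_hit z.+1) z0 => [//|y] _; exists y; last by rewrite -E.
exact: first_hitP Ez.
Qed.

Lemma hit_changes : exists2 k, k < 2 &
  [set s | first_hit s <> first_hit s.+1] #= `I_k.
Proof.
set W := [set s | _].
case: (pselect (exists s, W s)) => [[s Ws]|nW]; last first.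
  exists 0 => //; rewrite (_ : W = set0) ?II0 //.
  by apply/seteqP; split=> // s Ws; apply: nW; exists s.
exists 1 => //; suff -> : W = [set s] by exact: card_set1.
have W0 t : W t -> first_hit t = 0 /\ first_hit t.+1 <> 0.
  move=> Wt; have {Wt} : first_hit t <> first_hit t.+1 := Wt.
  by rewrite first_hitS; case: eqP => // t0; rewrite t0 => /nesym.
apply/seteqP; split=> t; last by move=> ->.
move=> /W0 [t0 t1]; have [s0 s1] := W0 _ Ws; apply/eqP.
rewrite eqn_leq; apply/andP; split; rewrite leqNgt; apply/negP => lt.
  by apply: (s1); rewrite -(first_hit_stable s1 lt).
by apply: (t1); rewrite -(first_hit_stable t1 lt).
Qed.

End FirstHit.

(** Turns an equality into a halting question for the halting problem. *)
Lemma halts_eq_ex : exists c, forall X s,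
  (exists y, eval X c s y) <-> pi1 s = pi2 s.
Proof.
have [|c [_ cP cT]] := @co_search_ex (fun z => ~~ (pi1 (pi1 z) == pi2 (pi1 z))).
  by comput.
exists c => X s; split=> [[y /cP]|E].
  by rewrite prK => /eqP; rewrite eqb0 negbK => /eqP.
by apply: cT; exists 0; rewrite prK E eqxx.
Qed.

Definition halts_eq : prog := projT1 (cid halts_eq_ex).

Lemma halts_eqP X s : (exists y, eval X halts_eq s y) <-> pi1 s = pi2 s.
Proof. by rewrite /halts_eq; case: (cid _) => c /=; apply. Qed.

Definition request_code (c n : nat) : nat :=
  pr 6 (pr c (pr 5 (pr (encode id_prog) (encode (const_prog n))))).

Definition target (m k : nat) : nat :=
  request_stage (request_code (pi1 m) (pr m k)).

(* An argument [m] codes three programs: a tracing program as in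
   [trace_program], one that recognizes the value found in a string, and one
   that bounds the numbers of the possible traces of the value at [m]. *)
Definition bound_code (m v : nat) : nat :=
  pr 6 (pr (encode halts_eq) (pr 5 (pr (encode (const_prog v))
    (pr 6 (pr (pi2 (pi2 m)) (encode (const_prog m))))))).

(** Here [u] pairs a number of changes with a node of guesses. The question is whether the string of
    that node yields [z] as traced value. Starting from [Zero] makes the string independent of [z],
    so each [u] excludes at most one [z]. *)
Definition value_code (m u z : nat) : nat :=
  pr 6 (pr (pi1 (pi2 m)) (pr 5 (pr
    (pr 6 (pr (path_code (pi2 u) (target m (pi1 u))) (encode Zero)))
    (encode (const_prog (pr (pr m (pi1 u)) z)))))).

(** The candidate [z] carries a guess [pi1 z] of the bound, and the halting problem verifies it; so
    the bounding program coded in [m] need not be run. *)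
Definition escapes (m z : nat) : bool :=
  `[< jump set0 (bound_code m (pi1 z)) >] &&
  all_below (pi1 z) (fun u => ~~ `[< jump set0 (value_code m u z) >]).

Definition diag (m : nat) : nat := hit (escapes m).

Lemma diag_BLR : BLR (jump set0) diag.
Proof.
exists (fun m => first_hit (escapes m)), (fun=> 2); split.
- have [c cP] : computable_on [set jump set0]
      (fun x => first_hit (escapes (pi1 x)) (pi2 x)).
    rewrite /first_hit /escapes /bound_code /value_code /target /request_stage.
    rewrite /request_code.
    by comput.
  by exists c => m s; have := cP _ erefl (pr m s); rewrite !prK.
- by have [c cP] := @co_const setT 2; exists c => n; exact: cP.
by move=> m; split; [exact: hitP | exact: hit_changes].
Qed.

Lemma jump_bound X b m v w : eval X b m w ->
  jump X (encode (Comp halts_eq (Pair (const_prog v) (Comp b (const_prog m)))))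
  <-> w = v.
Proof.
move=> bm; set e := encode _.
have arg y : eval X (Pair (const_prog v) (Comp b (const_prog m))) e y <->
    y = pr v w.
  split=> [[v' [w' [/eval_const -> [m' /eval_const -> bm'] ->]]]|->].
    by rewrite (eval_fun bm' bm).
  exists v, w; split=> //; first exact/eval_const.
  by exists m => //; exact/eval_const.
rewrite jumpE -/e; split=> [[y [u /arg -> hu]]|wv].
  have /halts_eqP : exists y, eval X halts_eq (pr v w) y by exists y.
  by rewrite !prK.
have [|y hy] := (halts_eqP X (pr v w)).2; first by rewrite !prK.
by exists y, (pr v w) => //; exact/arg.
Qed.

(** * The diagonal argument *)

Lemma encode_Pair Q i p : encode Q = pr 5 (pr i p) ->
  exists c P, [/\ Q = Pair c P, encode c = i & encode P = p].
Proof.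
case: Q => [||||| f g | f g | f g | f] /= /pr_inj [] // _ /pr_inj [<- <-].
by exists f, g.
Qed.

(** Each [u] excludes at most one value, and [pr v y] is at least [y], so a large [y] escapes them
    all. *)
Lemma avoid (R : nat -> nat -> Prop) v :
    (forall u y z, R u y -> R u z -> y = z) ->
  exists y, forall u, u < v -> ~ R u (pr v y).
Proof.
move=> Rfun; have [|y yP] := @uniform_bound (fun u l => ~ R u (pr v l)) v.
  move=> u _; case: (pselect (exists z, R u z)) => [[z Rz]|nR].
    exists z.+1 => l lt_zl /(Rfun _ _ _ Rz) E.
    by move: (leq_prr v l); rewrite -E leqNgt lt_zl.
  by exists 0 => l _ Rl; apply: nR; exists (pr v l).
by exists y => u /yP; apply.
Qed.

(* [d] searches for the first stage preceded by [k] changes. *)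
Lemma last_value A ft f g : computable_in2 A ft ->
    (forall n, limit_of (ft n) (f n) /\
       exists2 k, k < g n & [set s | ft n s <> ft n s.+1] #= `I_k) ->
  exists d, forall n, exists2 k, k < g n & eval A d (pr n k) (f n).
Proof.
move=> [c cP] ftP.
pose changes n s := \sum_(i < s) (ft n i != ft n i.+1).
have changesS n s : changes n s.+1 = changes n s + (ft n s != ft n s.+1).
  by rewrite /changes big_ord_recr.
have cft : computable_on [set A] (fun x => ft (pi1 x) (pi2 x)).
  by exists c => X -> x; rewrite -{1}(pr_eta x).
have cft2 a b : computable_on [set A] a -> computable_on [set A] b ->
    computable_on [set A] (fun x => ft (a x) (b x)).
  move=> ca cb; apply: (computable_on_ext
    (f := fun x => (fun x => ft (pi1 x) (pi2 x)) (pr (a x) (b x)))).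
    by move=> x; rewrite /= !prK.
  by apply: (co_comp cft); comput.
have [q qP] : computable_on [set A]
    (fun z => ~~ (changes (pi1 (pi1 z)) (pi2 z) == pi2 (pi1 z))).
  apply/co_neg/co_eq; last by comput.
  by apply: (co_sum (G := fun z i =>
    nat_of_bool (~~ (ft (pi1 (pi1 z)) i == ft (pi1 (pi1 z)) i.+1)))); comput.
have qE x s v : eval A q (pr x s) v <-> v = ~~ (changes (pi1 x) s == pi2 x).
  have := qP A erefl (pr x s); rewrite !prK => qs.
  by split=> [/eval_fun|->]; [apply|].
exists (Comp c (Pair Fst (Mu q))) => n.
have [[s0 s0P] [k lt_k Ck]] := ftP n.
exists (changes n s0).
  apply: leq_ltn_trans lt_k; have /card_set_bijP [h [hC hinj _]] := Ck.
  (* The changes before [s0], which [h] maps injectively to numbers below [k]. *)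
  pose l := [seq i <- iota 0 s0 | ft n i != ft n i.+1].
  have lC i : i \in l -> [set s | ft n s <> ft n s.+1] i.
    by rewrite mem_filter => /andP[/eqP Ci _]; exact: Ci.
  have -> : changes n s0 = size (map h l).
    rewrite size_map size_filter; elim: (s0) => [|s IHs].
      by rewrite /changes big_ord0.
    have -> : iota 0 s.+1 = iota 0 s ++ [:: s] by rewrite -addn1 iotaD.
    by rewrite changesS IHs count_cat /= addn0.
  rewrite -(size_iota 0 k); apply: uniq_leq_size.
    rewrite map_inj_in_uniq ?filter_uniq ?iota_uniq // => i j /lC Ci /lC Cj.
    by apply: hinj; exact/mem_set.
  by move=> _ /mapP [i /lC Ci ->]; rewrite mem_iota; exact: hC.
have ex : exists s, changes n s == changes n s0 by exists s0.
case: (ex_minnP ex) => s /eqP sE smin.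
have le_s : s <= s0 by exact: smin.
(* The counts at [s] and [s0] agree, so no change occurs in between and the value at [s] is already
   the limit. *)
have ft_s : ft n s = f n.
  rewrite -(s0P s0 (leqnn _)); move: sE; rewrite -(subnKC le_s).
  elim: (s0 - s) => [|e IHe]; first by rewrite addn0.
  have le_e : changes n s <= changes n (s + e).
    elim: (e) => [|e' IHe']; first by rewrite addn0.
    by rewrite addnS changesS (leq_trans IHe') // leq_addr.
  rewrite addnS changesS; case: eqP => [<-|_ E]; first by rewrite addn0.
  by move: le_e; rewrite E addn1 ltnn.
exists (pr n s); last by rewrite -ft_s; exact: cP.
exists n, s; split=> //; first by rewrite /= -/(pi1 _) prK.
split; first by apply/qE; rewrite !prK sE eqxx.
move=> m lt_m; exists 0; apply/qE; rewrite !prK.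
case: eqP => // E; have := smin m; rewrite E eqxx => /(_ isT).
by rewrite leqNgt lt_m.
Qed.

Lemma gen_not_BLR_hard : ~ BLR_hard gen.
Proof.
move=> /(_ _ diag_BLR) [ft [g [cft [cg cgP] ftP]]].
have [d dP] := last_value cft ftP.
have [F simF] := simulation d; have [c cT] := trace_program simF.
have [cF _ _] := simF.
(* The recognizer tests for [z.+2]: [diag] shifts its witness [z] by one, and the simulation shifts
   its output by one more. *)
have [|v [vXY vP vT]] := @co_search_ex
  (fun z => ~~ (F (pr (pi1 (pi1 z)) (pi1 (pi2 (pi1 z)))) == (pi2 (pi2 (pi1 z))).+2)).
  by comput.
have{}vP X t n z : (exists y, eval X v (pr t (pr n z)) y) <-> F (pr t n) = z.+2.
  split=> [[y /vP]|E]; first by rewrite !prK => /eqP; rewrite eqb0 negbK => /eqP.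
  by apply: vT; exists 0; rewrite !prK E eqxx.
(* Each summand exceeds [pr k g'] for every node [g'] of level [target m k], so [B m] bounds all
   possible traces. *)
pose B m := \sum_(k < g m)
  (2 * (k + 2 ^ target m k) + 2) * (2 * (k + 2 ^ target m k) + 2).
have [b bP] : computable_on [set set0] B.
  have cg' : computable_on [set set0] g by exists cg => X ->.
  apply: (co_sum (G := fun m k =>
    (2 * (k + 2 ^ target m k) + 2) * (2 * (k + 2 ^ target m k) + 2))) => //.
  rewrite /target /request_stage /request_code.
  by comput.
(* The argument at which [diag] defeats the approximation codes the very programs that trace,
   recognize and bound. *)
set m := pr (encode c) (pr (encode v) (encode b)).
have boundE w : jump set0 (bound_code m w) <-> B m = w.
  by rewrite /bound_code {1}/m !prK; exact: jump_bound (bP _ erefl m).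
have valueE u z : jump set0 (value_code m u z) <->
    exists P t, [/\ encode P = path_code (pi2 u) (target m (pi1 u)),
      eval set0 P 0 t & F (pr t (pr m (pi1 u))) = z.+2].
  rewrite /value_code {1}/m !prK; split.
    move=> [y [Q /[dup] eQ /encode_Comp [v' [R [eQ' /encode_inj ev eR]]]]].
    have [R1 [R2 [eR' eR1 /encode_inj eR2]]] := encode_Pair eR.
    have [P [Z [eR1' eP /(@encode_inj _ Zero) eZ]]] := encode_Comp eR1.
    rewrite eQ' eR' eR1' eR2 ev eZ => -[w [t [n [[z' -> Pt] /eval_const -> ->]] vw]].
    exists P, t; split=> //; apply/(vP set0); by exists y.
  move=> [P [t [<- Pt /(vP set0) [y vy]]]].
  pose Q := Comp v (Pair (Comp P Zero) (const_prog (pr (pr m (pi1 u)) z))).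
  exists y, Q => //; exists (pr t (pr (pr m (pi1 u)) z)) => //.
  exists t, (pr (pr m (pi1 u)) z); split=> //; last exact/eval_const.
  by exists 0.
have [y yP] : exists y, forall u, u < B m ->
    ~ jump set0 (value_code m u (pr (B m) y)).
  apply: (avoid (R := fun u z => jump set0 (value_code m u z))).
  move=> u z z' /valueE [P [t [eP Pt Ft]]] /valueE [P' [t' [eP' Pt' Ft']]].
  move: eP' Pt' Ft'; rewrite -eP => /encode_inj -> /(eval_fun Pt) <-.
  by rewrite Ft => -[].
have [|z /andP[/asboolP/boundE Bz /all_belowP zP] hz] := @hit_found (escapes m).
  exists (pr (B m) y); rewrite /escapes prK; apply/andP; split.
    by apply/asboolP/boundE.
  by apply/all_belowP => u /yP nj; exact/asboolPn.
have [k lt_k] := dP m; rewrite /diag hz => /cT.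
set n := pr m k; set j := request_stage _ => Fz.
have jE : j = target m k.
  by rewrite /j /target /request_code {1}/m !prK.
(* The trace given by the true outcomes. It lies below the bound and yields [z], which [escapes]
   forbids. *)
pose u := pr k (num outcome j).
have lt_u : u < pi1 z.
  rewrite -Bz /B (bigD1 (Ordinal lt_k)) //=; apply: leq_trans (leq_addr _ _).
  have := @pr_lt_sqr k (num outcome j) (k + 2 ^ target m k).
  rewrite expnS expn1; apply; first exact: leq_addr.
  by apply: leq_trans (leq_addl _ _); rewrite -jE ltnW ?num_lt.
have := zP _ lt_u => /asboolPn; apply; apply/valueE.
have [P eP PP] := path_codeP (@on_path_num j).
by exists P, (stage j); rewrite /u !prK -jE; split=> //; exact/PP.
Qed.

Theorem mainTheorem3 : exists A : set nat, superhigh A /\ ~ BLR_hard A.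
Proof. by exists gen; split; [exact: superhigh_gen | exact: gen_not_BLR_hard]. Qed.
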